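(* $\mathsf{IS4}$ has finitely many $\{\neg,\Diamond\}$-modalities.
   Context: Fix a set $\mathrm{Prop}$ of propositional symbols. Modal formulas are given by the grammar $\varphi := \bot \mid p \mid \varphi\land\varphi \mid \varphi\lor\varphi \mid \varphi\to\varphi \mid \Box\varphi \mid \Diamond\varphi$ with $p\in\mathrm{Prop}$; $\Box$ and $\Diamond$ are not interdefinable. Put $\neg\varphi := \varphi\to\bot$. A relation is a preorder if it is reflexive and transitive. For a relation $R$ on $W$, a set $A\subseteq W$ is an $R$-upset iff $w\in A$ and $wRv$ imply $v\in A$. A birelational $\mathsf{CS4}$-model is a tuple $M=\langle W, W^\bot, \preceq, \sqsubseteq, V\rangle$ where $W$ is a set of worlds, $W^\bot\subseteq W$ is the set of fallible worlds, $\preceq$ and $\sqsubseteq$ are preorders on $W$, and $V:\mathrm{Prop}\to\mathcal{P}(W)$, such that: (i) $M$ is backward confluent: $w\sqsubseteq v\preceq v'$ implies there is $w'$ with $w\preceq w'$ and $w'\sqsubseteq v'$; (ii) for every $p\in\mathrm{Prop}$, $V(p)$ is a $\preceq$-upset and $W^\bot\subseteq V(p)$; (iii) $W^\bot$ is both a $\preceq$-upset and a $\sqsubseteq$-upset. An $\mathsf{IS4}$-model is a $\mathsf{CS4}$-model with $W^\bot=\emptyset$ which is (backward confluent and) forward confluent: $w\sqsubseteq v$ and $w\preceq w'$ imply there is $v'$ with $w'\sqsubseteq v'$ and $v\preceq v'$. Truth: $M,w\models p$ iff $w\in V(p)$; $M,w\models\bot$ iff $w\in W^\bot$; $\land,\lor$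 are evaluated pointwise; $M,w\models\varphi\to\psi$ iff for all $v$ with $w\preceq v$, $M,v\models\varphi$ implies $M,v\models\psi$; $M,w\models\Box\varphi$ iff for all $v,u$ with $w\preceq v$ and $v\sqsubseteq u$, $M,u\models\varphi$; $M,w\models\Diamond\varphi$ iff for all $v$ with $w\preceq v$ there is $u$ with $v\sqsubseteq u$ and $M,u\models\varphi$. Write $\|\varphi\|^M := \{w\in W\mid M,w\models\varphi\}$. For $X\subseteq\{\neg,\Box,\Diamond\}$, an $X$-modality is a finite (possibly empty) sequence $\sigma\in X^{<\omega}$; $\sigma\varphi$ denotes the formula obtained by prefixing $\sigma$ to $\varphi$. Modalities $\sigma,\tau$ are $\mathsf{IS4}$-equivalent if $\|\sigma\varphi\|^M=\|\tau\varphi\|^M$ for every $\mathsf{IS4}$-model $M$ and every formula $\varphi$. $\mathsf{IS4}$ has finitely many $X$-modalities iff there is a finite set $\Sigma\subseteq X^{<\omega}$ such that every $X$-modality is $\mathsf{IS4}$-equivalent to some $\sigma\in\Sigma$; otherwise it has infinitely many $X$-modalities. *)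

(* Defs.v *)
From Stdlib Require Import List RelationClasses.

(* [Atom] is the set of propositional symbols; subsets of a type are
   [Prop]-valued predicates on it. *)
Inductive formula (Atom : Type) : Type :=
| Bot : formula Atom
| Var : Atom -> formula Atom
| And : formula Atom -> formula Atom -> formula Atom
| Or  : formula Atom -> formula Atom -> formula Atom
| Imp : formula Atom -> formula Atom -> formula Atom
| Box : formula Atom -> formula Atom
| Dia : formula Atom -> formula Atom.

Arguments Bot {Atom}.
Arguments Var {Atom} _.
Arguments And {Atom} _ _.
Arguments Or {Atom} _ _.
Arguments Imp {Atom} _ _.
Arguments Box {Atom} _.
Arguments Dia {Atom} _.

Definition Neg {Atom : Type} (phi : formula Atom) : formula Atom := Imp phi Bot.

Definition upset {W : Type} (R : W -> W -> Prop) (A : W -> Prop) : Prop :=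
  forall w v, A w -> R w v -> A v.

Definition backward_confluent {W : Type} (le acc : W -> W -> Prop) : Prop :=
  forall w v v', acc w v -> le v v' -> exists w', le w w' /\ acc w' v'.

Definition forward_confluent {W : Type} (le acc : W -> W -> Prop) : Prop :=
  forall w v w', acc w v -> le w w' -> exists v', acc w' v' /\ le v v'.

(* [le] is the intuitionistic preorder and [acc] the modal one. *)
Record CS4_model (Atom : Type) : Type := {
  world :> Type;
  fallible : world -> Prop;
  le : world -> world -> Prop;
  acc : world -> world -> Prop;
  val : Atom -> world -> Prop;
  le_preorder : PreOrder le;
  acc_preorder : PreOrder acc;
  CS4_backward : backward_confluent le acc;
  val_upset : forall p, upset le (val p);
  val_fallible : forall p w, fallible w -> val p w;
  fallible_le_upset : upset le fallible;
  fallible_acc_upset : upset acc fallible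
}.

Arguments fallible {Atom} _ _.
Arguments le {Atom} _ _ _.
Arguments acc {Atom} _ _ _.
Arguments val {Atom} _ _ _.

Definition is_IS4_model {Atom : Type} (M : CS4_model Atom) : Prop :=
  (forall w : M, ~ fallible M w) /\ forward_confluent (le M) (acc M).

Fixpoint truth {Atom : Type} (M : CS4_model Atom) (w : M) (phi : formula Atom)
    : Prop :=
  match phi with
  | Bot => fallible M w
  | Var p => val M p w
  | And a b => truth M w a /\ truth M w b
  | Or a b => truth M w a \/ truth M w b
  | Imp a b => forall v, le M w v -> truth M v a -> truth M v b
  | Box a => forall v u, le M w v -> acc M v u -> truth M u a
  | Dia a => forall v, le M w v -> exists u, acc M v u /\ truth M u a
  end.

Inductive modal_op : Type := NegOp | BoxOp | DiaOp.

Definition apply_op {Atom : Type} (o : modal_op) (phi : formula Atom)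
    : formula Atom :=
  match o with
  | NegOp => Neg phi
  | BoxOp => Box phi
  | DiaOp => Dia phi
  end.

(* The head of the list is the outermost operator. *)
Definition prefix {Atom : Type} (sigma : list modal_op) (phi : formula Atom)
    : formula Atom :=
  fold_right apply_op phi sigma.

Definition modality (X : modal_op -> Prop) (sigma : list modal_op) : Prop :=
  Forall X sigma.

Definition IS4_equivalent (Atom : Type) (sigma tau : list modal_op) : Prop :=
  forall M : CS4_model Atom, is_IS4_model M ->
  forall (phi : formula Atom) (w : M),
    truth M w (prefix sigma phi) <-> truth M w (prefix tau phi).

(* The finite set of representatives is given by a list enumerating it. *)
Definition IS4_finitely_many_modalities (Atom : Type) (X : modal_op -> Prop)
    : Prop :=
  exists Sigma : list (list modal_op),
    Forall (modality X) Sigma /\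
    forall tau, modality X tau ->
      exists sigma, In sigma Sigma /\ IS4_equivalent Atom tau sigma.

(* Main.v *)
From Stdlib Require Import List RelationClasses.
Require Import Defs.
Import ListNotations.

(** Write [N] and [D] for the two operators. In an IS4-model forward
    confluence makes [D phi] hold at [w] as soon as one [acc]-successor of [w]
    satisfies [phi] ([truth_Dia]), so [D D = D]; and [N N N = N] as in
    intuitionistic logic. The point is that [N D] is also a negation, taken
    along the composite relation [reach] of [le] followed by [acc]
    ([truth_Neg_Dia]). This has two consequences.

    First, a [reach]-negation cannot tell [phi] from [N N phi], because a world
    of [N N phi] cannot fail to have [phi] somewhere [le]-above it, which is
    still within reach: [N D N N = N D].

    Second, backward confluence makes [reach] a preorder, so the triple
    negation law [N D N D N D psi = N D psi] holds for every [psi] that persists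
    along [reach]. An arbitrary formula persists along [le] only, but
    [psi = N D phi] does persist along [reach]. Hence [(N D)^4 = (N D)^2], the
    analogue of the S4 law that [box dia box dia] is [box dia].

    These four laws bound the length of a reduced word. After its first [N], a
    reduced word has no [N N] following an [N D], so, apart from a leading [D]
    and a possible doubling of the first [N], it alternates between [N] and [D];
    and the alternation stops before [(N D)^4]. This leaves the 30 words of
    [normal_forms]. *)

(** * The semantic laws *)

Lemma truth_upset (Atom : Type) (M : CS4_model Atom) (phi : formula Atom) :
  upset (le M) (fun w => truth M w phi).
Proof.
  pose proof (le_preorder _ M) as [_ le_trans].
  induction phi as [|p|a IHa b IHb|a IHa b IHb|a _ b _|a _|a _];
    intros w v Hw wv; simpl in *.
  - exact (fallible_le_upset _ M w v Hw wv).
  - exact (val_upset _ M p w v Hw wv).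
  - destruct Hw as [Ha Hb]; split; [exact (IHa w v Ha wv)|exact (IHb w v Hb wv)].
  - destruct Hw as [Ha|Hb];
      [left; exact (IHa w v Ha wv)|right; exact (IHb w v Hb wv)].
  - intros x vx; apply Hw; exact (le_trans _ _ _ wv vx).
  - intros x u vx xu; exact (Hw x u (le_trans _ _ _ wv vx) xu).
  - intros x vx; apply Hw; exact (le_trans _ _ _ wv vx).
Qed.

(** The congruence that lets the inner part of a word be reduced first. *)
Lemma truth_apply_op (Atom : Type) (M : CS4_model Atom) (o : modal_op)
    (phi psi : formula Atom) :
  (forall w, truth M w phi <-> truth M w psi) ->
  forall w, truth M w (apply_op o phi) <-> truth M w (apply_op o psi).
Proof. intros H w; destruct o; simpl; firstorder. Qed.

Definition reach {Atom : Type} (M : CS4_model Atom) (w u : M) : Prop :=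
  exists v, le M w v /\ acc M v u.

Lemma reach_refl (Atom : Type) (M : CS4_model Atom) (w : M) : reach M w w.
Proof.
  exists w; split; [apply (le_preorder _ M)|apply (acc_preorder _ M)].
Qed.

Lemma le_reach (Atom : Type) (M : CS4_model Atom) (w v : M) :
  le M w v -> reach M w v.
Proof. intros wv; exists v; split; [exact wv|apply (acc_preorder _ M)]. Qed.

(** Backward confluence commutes the inner [acc] past the inner [le]. *)
Lemma reach_trans (Atom : Type) (M : CS4_model Atom) (w v u : M) :
  reach M w v -> reach M v u -> reach M w u.
Proof.
  intros [x [wx xv]] [y [vy yu]].
  destruct (CS4_backward _ M x v y xv vy) as [z [xz zy]].
  exists z; split.
  - exact (PreOrder_Transitive (PreOrder := le_preorder _ M) _ _ _ wx xz).
  - exact (PreOrder_Transitive (PreOrder := acc_preorder _ M) _ _ _ zy yu).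
Qed.

Section IS4Laws.

Context {Atom : Type} (M : CS4_model Atom) (HM : is_IS4_model M).

Lemma truth_Neg (phi : formula Atom) (w : M) :
  truth M w (Neg phi) <-> forall v, le M w v -> ~ truth M v phi.
Proof.
  destruct HM as [Hinf _]; split; intros H v wv Hv.
  - exact (Hinf v (H v wv Hv)).
  - destruct (H v wv Hv).
Qed.

(** A witness for [w] is carried along [le] by forward confluence and
    persistence. *)
Lemma truth_Dia (phi : formula Atom) (w : M) :
  truth M w (Dia phi) <-> exists u, acc M w u /\ truth M u phi.
Proof.
  destruct HM as [_ Hfwd]; split.
  - intros H; apply H; apply (le_preorder _ M).
  - intros [u [wu Hu]] v wv.
    destruct (Hfwd w u v wu wv) as [u' [vu' uu']].
    exists u'; split; [exact vu'|exact (truth_upset _ M phi u u' Hu uu')].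
Qed.

Lemma truth_Neg_Dia (phi : formula Atom) (w : M) :
  truth M w (Neg (Dia phi)) <-> forall u, reach M w u -> ~ truth M u phi.
Proof.
  rewrite truth_Neg; split.
  - intros H u [v [wv vu]] Hu; apply (H v wv), truth_Dia.
    exists u; split; assumption.
  - intros H v wv Hv; apply truth_Dia in Hv as [u [vu Hu]].
    apply (H u); [exists v; split; assumption|exact Hu].
Qed.

Lemma Dia_Dia (phi : formula Atom) (w : M) :
  truth M w (Dia (Dia phi)) <-> truth M w (Dia phi).
Proof.
  pose proof (acc_preorder _ M) as [acc_refl acc_trans].
  rewrite !truth_Dia; split.
  - intros [v [wv Hv]]; apply truth_Dia in Hv as [u [vu Hu]].
    exists u; split; [exact (acc_trans _ _ _ wv vu)|exact Hu].
  - intros H; exists w; split; [apply acc_refl|apply truth_Dia; exact H].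
Qed.

Lemma Neg_Neg_Neg (phi : formula Atom) (w : M) :
  truth M w (Neg (Neg (Neg phi))) <-> truth M w (Neg phi).
Proof.
  pose proof (le_preorder _ M) as [le_refl le_trans].
  rewrite truth_Neg, (truth_Neg phi); split; intros H v wv Hv.
  - apply (H v wv), truth_Neg; intros u vu Hu.
    rewrite truth_Neg in Hu; apply (Hu u (le_refl u)).
    exact (truth_upset _ M phi v u Hv vu).
  - rewrite truth_Neg in Hv; apply (Hv v (le_refl v)), truth_Neg.
    intros u vu; exact (H u (le_trans _ _ _ wv vu)).
Qed.

(** A world of [Neg (Neg phi)] within reach rules out that [phi] is out of
    reach, since every world [le]-above it is within reach too. *)
Lemma Neg_Dia_Neg_Neg (phi : formula Atom) (w : M) :
  truth M w (Neg (Dia (Neg (Neg phi)))) <-> truth M w (Neg (Dia phi)).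
Proof.
  pose proof (le_preorder _ M) as [le_refl _].
  rewrite !truth_Neg_Dia; split; intros H u wu Hu.
  - apply (H u wu), truth_Neg; intros v uv Hv.
    rewrite truth_Neg in Hv; apply (Hv v (le_refl v)).
    exact (truth_upset _ M phi u v Hu uv).
  - rewrite truth_Neg in Hu; apply (Hu u (le_refl u)), truth_Neg.
    intros v uv; apply H.
    exact (reach_trans _ M w u v wu (le_reach _ M u v uv)).
Qed.

Lemma Neg_Dia_reach_upset (phi : formula Atom) :
  upset (reach M) (fun w => truth M w (Neg (Dia phi))).
Proof.
  intros w v Hw wv; rewrite truth_Neg_Dia in *.
  intros u vu; exact (Hw u (reach_trans _ M w v u wv vu)).
Qed.

(** The usual proof of the triple negation law, for Kripke negation along the
    preorder [reach]. Persistence of [psi] is what makes [psi] imply its double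
    negation. *)
Lemma Neg_Dia_cube (psi : formula Atom) (w : M) :
  upset (reach M) (fun x => truth M x psi) ->
  truth M w (Neg (Dia (Neg (Dia (Neg (Dia psi)))))) <->
  truth M w (Neg (Dia psi)).
Proof.
  intros Hpsi.
  assert (double : forall chi v, upset (reach M) (fun x => truth M x chi) ->
            truth M v chi -> truth M v (Neg (Dia (Neg (Dia chi))))).
  { intros chi v Hchi Hv; apply truth_Neg_Dia; intros u vu Hu.
    rewrite truth_Neg_Dia in Hu; apply (Hu u (reach_refl _ M u)).
    exact (Hchi v u Hv vu). }
  split; [|exact (double _ w (Neg_Dia_reach_upset psi))].
  intros H; rewrite truth_Neg_Dia in H |- *.
  intros u wu Hu; exact (H u wu (double psi u Hpsi Hu)).
Qed.

Lemma Neg_Dia_four (phi : formula Atom) (w : M) :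
  truth M w (Neg (Dia (Neg (Dia (Neg (Dia (Neg (Dia phi)))))))) <->
  truth M w (Neg (Dia (Neg (Dia phi)))).
Proof. apply Neg_Dia_cube, Neg_Dia_reach_upset. Qed.

End IS4Laws.

(** * Reduced words *)

(** Meant for a reduced word [s], so that redexes are sought at the head only.
    The case [N D N N D] comes first because contracting [N D N N] to [N D]
    there creates the redex [D D]. *)
Definition cons_reduce (o : modal_op) (s : list modal_op) : list modal_op :=
  match o :: s with
  | DiaOp :: DiaOp :: r => DiaOp :: r
  | NegOp :: NegOp :: NegOp :: r => NegOp :: r
  | NegOp :: DiaOp :: NegOp :: NegOp :: DiaOp :: r => NegOp :: DiaOp :: r
  | NegOp :: DiaOp :: NegOp :: NegOp :: r => NegOp :: DiaOp :: r
  | NegOp :: DiaOp :: NegOp :: DiaOp :: NegOp :: DiaOp :: NegOp :: DiaOp :: r =>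
      NegOp :: DiaOp :: NegOp :: DiaOp :: r
  | s' => s'
  end.

Lemma cons_reduce_equivalent (Atom : Type) (o : modal_op) (s : list modal_op) :
  IS4_equivalent Atom (o :: s) (cons_reduce o s).
Proof.
  intros M HM phi w; unfold cons_reduce.
  repeat match goal with
  | |- context [match ?x with _ => _ end] => is_var x; destruct x
  end; cbn [prefix fold_right apply_op];
  first
    [ reflexivity
    | apply (Dia_Dia M HM)
    | apply (Neg_Neg_Neg M HM)
    | apply (Neg_Dia_four M HM)
    | apply (Neg_Dia_Neg_Neg M HM)
    | exact (iff_trans (Neg_Dia_Neg_Neg M HM (Dia _) w)
                       (truth_apply_op _ M NegOp _ _ (Dia_Dia M HM _) w)) ].
Qed.

Definition normal_forms : list (list modal_op) :=
  let cores :=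
    [ [DiaOp];
      [DiaOp; NegOp];
      [DiaOp; NegOp; DiaOp];
      [DiaOp; NegOp; DiaOp; NegOp];
      [DiaOp; NegOp; DiaOp; NegOp; DiaOp];
      [DiaOp; NegOp; DiaOp; NegOp; DiaOp; NegOp] ] in
  let undia := [] :: flat_map (fun c => [NegOp :: c; NegOp :: NegOp :: c])
                              ([] :: cores) in
  undia ++ map (cons DiaOp) undia.

Lemma normal_forms_modality :
  Forall (modality (fun o => o = NegOp \/ o = DiaOp)) normal_forms.
Proof.
  repeat (constructor; try solve [left; reflexivity | right; reflexivity]).
Qed.

Lemma cons_reduce_normal_forms (o : modal_op) (s : list modal_op) :
  o = NegOp \/ o = DiaOp -> In s normal_forms ->
  In (cons_reduce o s) normal_forms.
Proof.
  intros Ho Hs; revert s Hs; apply Forall_forall.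
  destruct Ho as [-> | ->];
    repeat (apply Forall_cons; [simpl; repeat ((left; reflexivity) || right)|]);
    apply Forall_nil.
Qed.

Theorem theorem11 (Atom : Type) :
  IS4_finitely_many_modalities Atom (fun o => o = NegOp \/ o = DiaOp).
Proof.
  exists normal_forms; split; [exact normal_forms_modality|].
  intros tau Htau.
  exists (fold_right cons_reduce [] tau); split.
  - induction Htau as [|o s Ho _ IH]; simpl; [left; reflexivity|].
    exact (cons_reduce_normal_forms o _ Ho IH).
  - clear Htau; intros M HM phi.
    induction tau as [|o s IH]; intros w; simpl; [reflexivity|].
    rewrite <- (cons_reduce_equivalent Atom o _ M HM phi w).
    exact (truth_apply_op _ M o _ _ IH w).
Qed.
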